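(* Let $p\in\Delta_{m-1}$, $\theta>0$, and let $\{p^\nu\}_{\nu\in\mathbb N}\subset\Delta_{m-1}$ and $\{\theta^\nu\}_{\nu\in\mathbb N}\subset(0,\infty)$ satisfy $p^\nu\to p$ and $\theta^\nu\to\theta$. For $(u,X)\in\mathbb R^m\times\mathbb R^n$ let $$f_1(u,X)=-\sum_{j=1}^m(p_j+u_j)\langle S_{T+1}(j),X_T(j^-)\rangle+\iota_{\mathcal X}(X)+\tfrac12\theta\|u\|_2^2+\iota_{[0,\infty)^m}(p+u),$$ $$f_1^\nu(u,X)=-\sum_{j=1}^m(p_j^\nu+u_j)\langle S_{T+1}(j),X_T(j^-)\rangle+\iota_{\mathcal X}(X)+\tfrac12\theta^\nu\|u\|_2^2+\iota_{[0,\infty)^m}(p^\nu+u),$$ and $\tilde f_1(u,X)=f_1(u,X)+\iota_{(-\infty,0]^m}(u)$, $\tilde f_1^\nu(u,X)=f_1^\nu(u,X)+\iota_{(-\infty,0]^m}(u)$. Then $f_1^\nu$ epi-converges to $f_1$, and moreover $\tilde f_1^\nu$ epi-converges to $\tilde f_1$.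
   Context: Scenario tree. Let $T,k\ge 1$ be integers and consider a finite rooted tree with levels $0,1,\dots,T+1$ (the history tree of a finitely supported discrete-time environment process), in which every node at a level $\le T$ has at least one child. For $0\le t\le T$, $I_t$ is the set of nodes at level $t$ ($I_0$ consists of the root), $n_t=|I_t|$, $N_T=\sum_{t=0}^T n_t$, $n=(k+1)N_T$. The terminal nodes (level $T+1$) are labeled $1,\dots,m$. For a node $i$, $i^-$ is its parent and $i^+$ its set of children. The terminal nodes are partitioned into original scenarios $I$ and added critical scenarios $\tilde I$ (all nodes at levels $\le T$ belong to the original tree). Market. Asset prices are $S_t(i)=(S_t^0,S_t^1(i),\dots,S_t^k(i))\in(0,\infty)^{k+1}$ for each node $i$ at level $t$; asset $0$ is risk-free (its price depends only on $t$). For $j\in\tilde I$ and $1\le i\le k$, $S^i_{T+1}(j)=\kappa_j^iS^i_T(j^-)$ with $\kappa_j^i>0$. The original market is arbitrage-free (no self-financing strategy with zero initial wealth has terminal wealth that is nonnegative a.s. and positive with positive probability). The claim is $G_0>0$ and $G_t(i)<0$ for $i\in I_t$, $1\le t\le T$. Probabilities. $\Delta_{m-1}=\{p\in\mathbb R^m_+:\sum_jp_j=1\}$; $p_j$ is the probability of terminal node $j$, with $p_j=0$ for $j\in\tilde I$; $p^\nu$ may charge any scenario. Strategies. $X\in\mathbb R^n$ is a family $X_t(i)\in\mathbb R^{k+1}$, $i\in I_t$, $0\le t\le T$. The (compact, convex) feasible set $\mathcal X$ consists of all $X$ with $X_t(i)\ge0$ componentwise for all $i\in I_t$, $0\le t\le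 T$; $\langle S_0,X_0\rangle\le G_0$; and $\langle S_t(i),X_t(i)-X_{t-1}(i^-)\rangle\le G_t(i)$ for all $i\in I_t$, $1\le t\le T$. $\iota_C$ is the indicator function ($0$ on $C$, $+\infty$ off $C$). Epi-convergence: $g^\nu:\mathbb R^N\to\overline{\mathbb R}$ epi-converges to $g$ if for every $x$: (1) $\liminf_\nu g^\nu(x^\nu)\ge g(x)$ for every $x^\nu\to x$; (2) there is $x^\nu\to x$ with $\limsup_\nu g^\nu(x^\nu)\le g(x)$. *)

(* Defs.v *)
From HB Require Import structures.
From mathcomp Require Import all_boot all_order all_algebra.
From mathcomp Require Import all_classical all_reals all_analysis.

Set Implicit Arguments.
Unset Strict Implicit.
Unset Printing Implicit Defensive.

Import Order.TTheory GRing.Theory Num.Theory.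
Import numFieldNormedType.Exports.

Local Open Scope classical_set_scope.
Local Open Scope ring_scope.

(* Non-terminal nodes (levels 0 to T) are labelled by 'I_N, so that N is the
   number N_T = n_0 + ... + n_T; terminal nodes (level T+1) by 'I_m.
   [parent (inl root_node)] is a junk value: [parent v] is only meaningful when v
   has positive level. *)
Definition node (N m : nat) : Type := ('I_N + 'I_m)%type.

Definition level_of (T N m : nat) (lev : 'I_N -> nat) (v : node N m) : nat :=
  match v with inl i => lev i | inr _ => T.+1 end.

Record scenario_tree (T N m : nat) := ScenarioTree {
  root_node : 'I_N ;
  inner_level : 'I_N -> nat ;
  parent : node N m -> 'I_N ;
  (* the added critical scenarios; the original scenarios are ~: critical *)
  critical : {set 'I_m} ;
  inner_level_le : forall i, (inner_level i <= T)%N ;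
  inner_level_root : forall i, inner_level i = 0%N <-> i = root_node ;
  level_parent : forall v : node N m, (0 < level_of T inner_level v)%N ->
    level_of T inner_level v = (inner_level (parent v)).+1 ;
  has_child : forall i, exists v : node N m,
    (0 < level_of T inner_level v)%N /\ parent v = i ;
  (* every node at level T lies on an original scenario, hence (with
     [has_child]) so does every non-terminal node *)
  has_original_child : forall i, inner_level i = T ->
    exists j : 'I_m, j \notin critical /\ parent (inr j) = i }.

Definition dotv (R : realType) (d : nat) (x y : 'rV[R]_d) : R :=
  \sum_(a < d) x ord0 a * y ord0 a.

(* The norm `|u| of the library on matrices is the max norm. *)
Definition norm2 (R : realType) (d : nat) (x : 'rV[R]_d) : R :=
  Num.sqrt (dotv x x).

(* Column [ord0] of a price vector is asset 0, and column [lift ord0 a], for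
   a : 'I_k, is the risky asset of index a + 1. *)
Record market (R : realType) (T N m k : nat) (tr : scenario_tree T N m) :=
  Market {
  price : node N m -> 'rV[R]_k.+1 ;
  (* only the rows of critical scenarios are meaningful *)
  kappa : 'I_m -> 'I_k -> R ;
  price_gt0 : forall v a, 0 < price v ord0 a ;
  price_riskfree : forall v w : node N m,
    level_of T (inner_level tr) v = level_of T (inner_level tr) w ->
    price v ord0 ord0 = price w ord0 ord0 ;
  kappa_gt0 : forall j a, j \in critical tr -> 0 < kappa j a ;
  price_critical : forall j a, j \in critical tr ->
    price (inr j) ord0 (lift ord0 a) =
    kappa j a * price (inl (parent tr (inr j))) ord0 (lift ord0 a) }.

Section Model.
Context (R : realType) (T N m k : nat) (tr : scenario_tree T N m).
Variable mk : market R k tr.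

(* A strategy X in R^((k+1) N_T) is a matrix; its row i is X_t(i). *)
Local Notation strategy := 'M[R]_(N, k.+1).

Definition trade_cost (X : strategy) (i : 'I_N) : R :=
  dotv (price mk (inl i)) (row i X - row (parent tr (inl i)) X).

Definition terminal_wealth (X : strategy) (j : 'I_m) : R :=
  dotv (price mk (inr j)) (row (parent tr (inr j)) X).

Definition initial_wealth (X : strategy) : R :=
  dotv (price mk (inl (root_node tr))) (row (root_node tr) X).

Definition self_financing (X : strategy) : Prop :=
  forall i, (0 < inner_level tr i)%N -> trade_cost X i = 0.

Definition arbitrage (p : 'rV[R]_m) (X : strategy) : Prop :=
  [/\ self_financing X, initial_wealth X = 0,
      forall j, 0 < p ord0 j -> 0 <= terminal_wealth X j
    & exists j, 0 < p ord0 j /\ 0 < terminal_wealth X j].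

(* Since p vanishes on the critical scenarios, this only involves the original
   market. *)
Definition arbitrage_free (p : 'rV[R]_m) : Prop :=
  forall X : strategy, ~ arbitrage p X.

Definition feasible (G : 'I_N -> R) : set strategy :=
  [set X : strategy | [/\ forall i a, 0 <= X i a,
               initial_wealth X <= G (root_node tr)
             & forall i, (0 < inner_level tr i)%N -> trade_cost X i <= G i]].

Definition simplex : set 'rV[R]_m :=
  [set p | (forall j, 0 <= p ord0 j) /\ \sum_j p ord0 j = 1].

Definition nonneg_orthant : set 'rV[R]_m := [set v | forall j, 0 <= v ord0 j].

Definition nonpos_orthant : set 'rV[R]_m := [set v | forall j, v ord0 j <= 0].

Definition iota_set (E : Type) (C : set E) (x : E) : \bar R :=
  if x \in C then 0%E else +oo%E.

Definition f1 (G : 'I_N -> R) (p : 'rV[R]_m) (theta : R)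
    (z : 'rV[R]_m * strategy) : \bar R :=
  let: (u, X) := z in
  ((- \sum_(j < m) (p ord0 j + u ord0 j) * terminal_wealth X j)%:E
   + iota_set (feasible G) X
   + (2^-1 * theta * norm2 u ^+ 2)%:E
   + iota_set nonneg_orthant (p + u)%R)%E.

Definition f1_tilde (G : 'I_N -> R) (p : 'rV[R]_m) (theta : R)
    (z : 'rV[R]_m * strategy) : \bar R :=
  (f1 G p theta z + iota_set nonpos_orthant z.1)%E.

End Model.

Definition epi_converges (R : realType) (E : topologicalType)
    (gs : nat -> E -> \bar R) (g : E -> \bar R) : Prop :=
  forall x : E,
    (forall xs : nat -> E, xs @ \oo --> x ->
       (g x <= limn_einf (fun nu => gs nu (xs nu)))%E) /\
    (exists xs : nat -> E, xs @ \oo --> x /\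
       (limn_esup (fun nu => gs nu (xs nu)) <= g x)%E).

Arguments simplex : clear implicits.

(* Main.v *)
(* Both objectives are the sum of a finite part, jointly continuous in all its
   arguments including (p, theta), and of the indicator of a domain depending on
   p^nu. A sum of this shape epi-converges as soon as the finite parts converge
   continuously and the domains converge in the sense of Painleve-Kuratowski.
   Outer convergence of the domains is closedness of the feasible set and of the
   orthants; for inner convergence, (u, X) is approached by
   (max(u, - p^nu), X), which keeps p^nu + u^nu >= 0, keeps u^nu <= 0 when
   u <= 0, and converges to (u, X) because p + u >= 0. *)
Require Import Defs.
From HB Require Import structures.
From mathcomp Require Import all_boot all_order all_algebra.
From mathcomp Require Import all_classical all_reals all_analysis.

Import Order.TTheory GRing.Theory Num.Theory.
Import numFieldNormedType.Exports.

Local Open Scope classical_set_scope.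
Local Open Scope ring_scope.

Set Implicit Arguments.
Unset Strict Implicit.
Unset Printing Implicit Defensive.

(** * Lower and upper limits, indicators, and an abstract epi-convergence criterion *)

Lemma le_near_limn_esup (R : realType) (u v : (\bar R)^nat) :
  (\forall n \near \oo, (u n <= v n)%E) -> (limn_esup u <= limn_esup v)%E.
Proof.
move=> uv; rewrite /limn_esup !limf_esupE.
apply: le_ereal_inf_tmp => _ [W oW <-].
(* The upper limit is an infimum over sets of the filter. Cutting [W] down to the indices where the
   inequality holds stays in the filter, and there the supremum of [u] is at most that of [v] over
   [W]. *)
pose W' := W `&` [set n | (u n <= v n)%E].
apply: (@le_trans _ _ (ereal_sup (u @` W'))).
  by apply: ereal_inf_lbound; exists W' => //; exact: filterI.
apply: ge_ereal_sup => _ [n [Wn uvn] <-]; apply: le_trans uvn _.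
by apply: ereal_sup_ubound; exists n.
Qed.

Lemma le_near_limn_einf (R : realType) (u v : (\bar R)^nat) :
  (\forall n \near \oo, (u n <= v n)%E) -> (limn_einf u <= limn_einf v)%E.
Proof.
move=> uv; rewrite /limn_einf leeN2; apply: le_near_limn_esup.
by apply: filterS uv => n; rewrite leeN2.
Qed.

Lemma iota_set_in (R : realType) (E : Type) (C : set E) (x : E) :
  C x -> iota_set R C x = 0%E.
Proof. by move=> Cx; rewrite /iota_set mem_set. Qed.

Lemma iota_set_notin (R : realType) (E : Type) (C : set E) (x : E) :
  ~ C x -> iota_set R C x = +oo%E.
Proof. by move=> Cx; rewrite /iota_set memNset. Qed.

Lemma iota_setI (R : realType) (E : Type) (A B : set E) (x : E) :
  iota_set R (A `&` B) x = (iota_set R A x + iota_set R B x)%E.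
Proof.
rewrite /iota_set in_setI.
by case: (x \in A); case: (x \in B); rewrite ?add0e.
Qed.

(* The last two hypotheses are the outer and inner halves of the sequential
   Painleve-Kuratowski convergence of [A nu] to [A0]. *)
Lemma epi_converges_iota (R : realType) (E : topologicalType)
    (F : nat -> E -> R) (F0 : E -> R) (A : nat -> set E) (A0 : set E) :
  (forall (xs : nat -> E) x, xs @ \oo --> x ->
     (fun nu => F nu (xs nu)) @ \oo --> F0 x) ->
  (forall (xs : nat -> E) x, xs @ \oo --> x -> ~ A0 x ->
     \forall nu \near \oo, ~ A nu (xs nu)) ->
  (forall x, A0 x -> exists xs : nat -> E,
     xs @ \oo --> x /\ forall nu, A nu (xs nu)) ->
  epi_converges (fun nu x => ((F nu x)%:E + iota_set R (A nu) x)%E)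
                (fun x => ((F0 x)%:E + iota_set R A0 x)%E).
Proof.
move=> cvgF Aout Ain x.
have cvgFE xs : xs @ \oo --> x ->
    (fun nu => (F nu (xs nu))%:E) @ \oo --> (F0 x)%:E.
  by move=> /cvgF h; apply: cvg_EFin => //; exact: nearW.
split=> [xs xsx|]; have [A0x|A0x] := pselect (A0 x).
(* On the limit domain the indicators of [A nu] can only raise the values, so the limit of the
   finite parts is a lower bound wherever [xs] lies. *)
- rewrite iota_set_in // adde0.
  have [<- _] := cvg_limn_einf_sup (cvgFE _ xsx).
  apply: le_near_limn_einf; apply: nearW => nu.
  by rewrite leeDl // /iota_set; case: ifP => _; rewrite ?leey.
(* Off the limit domain the outer hypothesis makes the values eventually [+oo]. *)
- rewrite iota_set_notin //.
  have [pinf _] := cvg_limn_einf_sup (cvg_cst (+oo%E : \bar R)).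
  rewrite -[leLHS]pinf; apply: le_near_limn_einf.
  apply: filterS (Aout _ _ xsx A0x) => nu Anu.
  by rewrite iota_set_notin.
- have [xs [xsx Axs]] := Ain _ A0x; exists xs; split=> //.
  rewrite iota_set_in // adde0.
  have [_ <-] := cvg_limn_einf_sup (cvgFE _ xsx).
  apply: le_near_limn_esup; apply: nearW => nu.
  by rewrite iota_set_in // adde0.
(* Here the limit value is [+oo], so any sequence converging to [x] will do. *)
- exists (fun=> x); split; first exact: cvg_cst.
  by rewrite iota_set_notin // leey.
Qed.

(** * Entrywise convergence of matrices and inner products *)

Lemma cvg_mx_coord (T : topologicalType) (a b : nat) (I : Type)
    (F : set_system I) {FF : Filter F} (f : I -> 'M[T]_(a, b))
    (M : 'M[T]_(a, b)) :
  (forall i j, (fun n => f n i j) @ F --> M i j) -> f @ F --> M.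
Proof.
move=> cvgf A [P MP PA]; rewrite /nbhs /=.
(* A neighbourhood of [M] contains a box of entrywise neighbourhoods [P i j]; as there are finitely
   many entries, the filter allows one common eventual condition. *)
have : \forall n \near F, forall ij : 'I_a * 'I_b, P ij.1 ij.2 (f n ij.1 ij.2).
  by apply: filter_forall => -[i j]; exact: (cvgf i j _ (MP i j)).
by apply: filterS => n Pn; apply: PA => i j; exact: (Pn (i, j)).
Qed.

Lemma cvg_coord (R : realType) (a b : nat) (I : Type)
    (F : set_system I) {FF : Filter F} (f : I -> 'M[R]_(a, b))
    (M : 'M[R]_(a, b)) i j :
  f @ F --> M -> (fun n => f n i j) @ F --> M i j.
Proof.
by move=> fM; exact: (cvg_comp _ _ fM (@coord_continuous _ _ _ i j M)).
Qed.

Lemma cvg_row (R : realType) (a b : nat) (I : Type)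
    (F : set_system I) {FF : Filter F} (f : I -> 'M[R]_(a, b))
    (M : 'M[R]_(a, b)) i :
  f @ F --> M -> (fun n => row i (f n)) @ F --> row i M.
Proof.
move=> fM; apply: cvg_mx_coord => i' j; rewrite mxE.
by under eq_fun do rewrite mxE; exact: cvg_coord.
Qed.

Lemma cvg_dotv (R : realType) (d : nat) (I : Type)
    (F : set_system I) {FF : Filter F} (f g : I -> 'rV[R]_d) (x y : 'rV[R]_d) :
  f @ F --> x -> g @ F --> y ->
  (fun n => dotv (f n) (g n)) @ F --> dotv x y.
Proof.
move=> fx gy; apply: cvg_big => [|a _]; first exact: add_continuous.
by apply: cvgM; exact: cvg_coord.
Qed.

(** Turns the quadratic penalty into an inner product, whose convergence is [cvg_dotv]. *)
Lemma norm2_sqr (R : realType) (d : nat) (x : 'rV[R]_d) :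
  norm2 x ^+ 2 = dotv x x.
Proof. by rewrite sqr_sqrtr // sumr_ge0 // => a _; rewrite -expr2 sqr_ge0. Qed.

(** * Closedness of the constraint sets *)

Lemma closed_nonneg_orthant (R : realType) (m : nat) :
  closed (@nonneg_orthant R m).
Proof.
have -> : @nonneg_orthant R m =
    \bigcap_j ((fun v : 'rV[R]_m => v ord0 j) @^-1` [set x | 0 <= x]).
  by apply/seteqP; split=> v /= h j => [_|]; exact: h.
apply: closed_bigI => j _; apply: preimage_closed; last exact: closed_ge.
by move=> v _; exact: coord_continuous.
Qed.

Lemma closed_nonpos_orthant (R : realType) (m : nat) :
  closed (@nonpos_orthant R m).
Proof.
have -> : @nonpos_orthant R m =
    \bigcap_j ((fun v : 'rV[R]_m => v ord0 j) @^-1` [set x | x <= 0]).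
  by apply/seteqP; split=> v /= h j => [_|]; exact: h.
apply: closed_bigI => j _; apply: preimage_closed; last exact: closed_le.
by move=> v _; exact: coord_continuous.
Qed.

Section market_topology.
Context (R : realType) (T N m k : nat) (tr : scenario_tree T N m).
Variables (mk : market R k tr) (G : 'I_N -> R).
Local Notation strategy := 'M[R]_(N, k.+1).

Lemma cvg_terminal_wealth (I : Type) (F : set_system I) {FF : Filter F}
    (f : I -> strategy) (X : strategy) j :
  f @ F --> X ->
  (fun n => terminal_wealth mk (f n) j) @ F --> terminal_wealth mk X j.
Proof. by move=> fX; apply: cvg_dotv; [exact: cvg_cst|exact: cvg_row]. Qed.

Lemma continuous_initial_wealth : continuous (initial_wealth mk).
Proof.
move=> X.
exact: (cvg_dotv (cvg_cst (price mk (inl (root_node tr))))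
  (cvg_row (i := root_node tr) (@cvg_id _ (nbhs X)))).
Qed.

Lemma continuous_trade_cost i : continuous (fun X => trade_cost mk X i).
Proof.
move=> X.
exact: (cvg_dotv (cvg_cst (price mk (inl i)))
  (cvgB (cvg_row (i := i) (@cvg_id _ (nbhs X)))
        (cvg_row (i := parent tr (inl i)) (@cvg_id _ (nbhs X))))).
Qed.

(** Every constraint is a weak inequality on a continuous function of [X], so the set is an
    intersection of preimages of closed half-lines. *)
Lemma closed_feasible : closed (feasible mk G).
Proof.
have -> : feasible mk G =
    (\bigcap_ia ((fun X : strategy => X ia.1 ia.2) @^-1` [set x | 0 <= x])) `&`
    (initial_wealth mk @^-1` [set x | x <= G (root_node tr)] `&`
    \bigcap_(i in [set i | (0 < inner_level tr i)%N])
      ((fun X => trade_cost mk X i) @^-1` [set x | x <= G i])).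
  apply/seteqP; split=> X /=.
    by move=> [h1 h2 h3]; split=> [[i a] _|]; [exact: h1|split].
  by move=> [h1 [h2 h3]]; split=> // i a; exact: (h1 (i, a)).
apply: closedI; [|apply: closedI].
- apply: closed_bigI => -[i a] _; apply: preimage_closed; last exact: closed_ge.
  by move=> X _; exact: coord_continuous.
- apply: preimage_closed; last exact: closed_le.
  by move=> X _; exact: continuous_initial_wealth.
- apply: closed_bigI => i _; apply: preimage_closed; last exact: closed_le.
  by move=> X _; exact: continuous_trade_cost.
Qed.

End market_topology.

(** * Tools for the outer and inner limits of the domains *)

Lemma closed_near_notin (E : topologicalType) (C : set E) (xs : nat -> E) x :
  closed C -> xs @ \oo --> x -> ~ C x -> \forall nu \near \oo, ~ C (xs nu).
Proof.
by move=> /closed_openC oC xsx Cx; exact: (xsx _ (open_nbhs_nbhs (conj oC Cx))).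
Qed.

(** The sign condition is kept as a conditional last clause so that the same sequence serves both
    objectives. *)
Lemma recovery_sequence (R : realType) (m : nat) (p : 'rV[R]_m)
    (ps : nat -> 'rV[R]_m) (u : 'rV[R]_m) :
  ps @ \oo --> p -> nonneg_orthant (p + u) ->
  exists us : nat -> 'rV[R]_m, [/\ us @ \oo --> u,
    forall nu, nonneg_orthant (ps nu + us nu) &
    (forall nu, nonneg_orthant (ps nu)) -> nonpos_orthant u ->
      forall nu, nonpos_orthant (us nu)].
Proof.
move=> psp pu.
exists (fun nu => \row_j Num.max (u ord0 j) (- ps nu ord0 j)); split.
- apply: cvg_mx_coord => i j; rewrite (ord1 i).
  under eq_fun do rewrite mxE.
  (* The clipped entries tend to the maximum with [- p], and [p + u >= 0] says that the clipping is
     inactive in the limit. *)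
  have uE : Num.max (u ord0 j) (- p ord0 j) = u ord0 j.
    by apply/max_idPl; rewrite -subr_ge0 opprK; have := pu j; rewrite mxE addrC.
  have psj : (fun nu => - ps nu ord0 j) @ \oo --> - p ord0 j.
    by apply: cvgN; exact: cvg_coord.
  rewrite -[X in nbhs X]uE.
  apply: (@continuous2_cvg _ _ _ _ _ _ (fun=> u ord0 j) _ Num.max) psj.
    exact: (@max_continuous _ R (u ord0 j, - p ord0 j)).
  exact: cvg_cst.
- by move=> nu j; rewrite !mxE -lerBlDl sub0r le_max lexx orbT.
- by move=> ps0 u0 nu j; rewrite mxE ge_max u0 oppr_le0 ps0.
Qed.

Lemma cvg_prod_fst (U V : topologicalType) (I : Type) (F : set_system I)
    {FF : Filter F} (f : I -> U * V) (z : U * V) :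
  f @ F --> z -> (fun n => (f n).1) @ F --> z.1.
Proof. by move=> fz; exact: (cvg_comp _ _ fz cvg_fst). Qed.

Lemma cvg_prod_snd (U V : topologicalType) (I : Type) (F : set_system I)
    {FF : Filter F} (f : I -> U * V) (z : U * V) :
  f @ F --> z -> (fun n => (f n).2) @ F --> z.2.
Proof. by move=> fz; exact: (cvg_comp _ _ fz cvg_snd). Qed.

(** * The two objectives as a finite part plus the indicator of a domain *)

Section objective.
Context (R : realType) (T N m k : nat) (tr : scenario_tree T N m).
Variables (mk : market R k tr) (G : 'I_N -> R).
Local Notation strategy := 'M[R]_(N, k.+1).

Definition finite_part (p : 'rV[R]_m) (theta : R)
    (z : 'rV[R]_m * strategy) : R :=
  - (\sum_(j < m) (p ord0 j + z.1 ord0 j) * terminal_wealth mk z.2 j)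
  + 2^-1 * theta * norm2 z.1 ^+ 2.

Definition effective_domain (p : 'rV[R]_m) : set ('rV[R]_m * strategy) :=
  [set z | feasible mk G z.2 /\ nonneg_orthant (p + z.1)].

Lemma f1E p theta :
  f1 mk G p theta =
  (fun z => (finite_part p theta z)%:E + iota_set R (effective_domain p) z)%E.
Proof.
apply/funext => -[u X]; rewrite /f1 /finite_part /=.
(* The quadratic term moves past the first indicator: the two real terms merge, and the two
   indicators become adjacent. *)
rewrite -(addeA _ _ (_ * _)%:E) (addeC (iota_set _ _ _)) addeA -EFinD -addeA.
congr (_ + _)%E; rewrite [RHS](iota_setI _ [set z | feasible mk G z.2]
  [set z | nonneg_orthant (p + z.1)]).
by rewrite /iota_set; congr (_ + _)%E; rewrite !in_setE.
Qed.

Lemma f1_tildeE p theta :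
  f1_tilde mk G p theta =
  (fun z => (finite_part p theta z)%:E +
    iota_set R (effective_domain p `&` [set z | nonpos_orthant z.1]) z)%E.
Proof.
apply/funext => z; rewrite /f1_tilde f1E iota_setI addeA.
by congr (_ + _)%E.
Qed.

Lemma cvg_finite_part (ps : nat -> 'rV[R]_m) (thetas : nat -> R) (p : 'rV[R]_m)
    (theta : R) (zs : nat -> 'rV[R]_m * strategy) (z : 'rV[R]_m * strategy) :
  ps @ \oo --> p -> thetas @ \oo --> theta -> zs @ \oo --> z ->
  (fun nu => finite_part (ps nu) (thetas nu) (zs nu)) @ \oo -->
  finite_part p theta z.
Proof.
move=> psp thetas_cvg zsz.
have us : (fun nu => (zs nu).1) @ \oo --> z.1 by exact: cvg_prod_fst.
have Xs : (fun nu => (zs nu).2) @ \oo --> z.2 by exact: cvg_prod_snd.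
apply: cvgD.
  apply: cvgN; apply: cvg_big => [|j _]; first exact: add_continuous.
  exact: (cvgM (cvgD (cvg_coord psp) (cvg_coord us)) (cvg_terminal_wealth Xs)).
rewrite norm2_sqr; under eq_fun do rewrite norm2_sqr.
by apply: cvgM; [exact: cvgMl_tmp|exact: cvg_dotv].
Qed.

(** The moving constraint on [u] is a fixed closed one on the sum [ps nu + (zs nu).1], which
    converges to [p + z.1]. Whichever constraint [z] violates is then violated eventually along the
    sequence. *)
Lemma effective_domain_near_notin (ps : nat -> 'rV[R]_m) (p : 'rV[R]_m)
    (zs : nat -> 'rV[R]_m * strategy) (z : 'rV[R]_m * strategy) :
  ps @ \oo --> p -> zs @ \oo --> z -> ~ effective_domain p z ->
  \forall nu \near \oo, ~ effective_domain (ps nu) (zs nu).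
Proof.
move=> psp zsz.
have us : (fun nu => (zs nu).1) @ \oo --> z.1 by exact: cvg_prod_fst.
have Xs : (fun nu => (zs nu).2) @ \oo --> z.2 by exact: cvg_prod_snd.
have [Xf|Xf _] := pselect (feasible mk G z.2); last first.
  have := closed_near_notin (closed_feasible (mk := mk) (G := G)) Xs Xf.
  by apply: filterS => nu h [].
have [pu []//|pu _] := pselect (nonneg_orthant (p + z.1)).
have pus : (fun nu => ps nu + (zs nu).1) @ \oo --> p + z.1 by exact: cvgD.
have := closed_near_notin (@closed_nonneg_orthant R m) pus pu.
by apply: filterS => nu h [].
Qed.

End objective.

Unset Implicit Arguments.

Theorem proposition3p3 (R : realType) (T k N m : nat)
    (hT : (1 <= T)%N) (hk : (1 <= k)%N)
    (tr : scenario_tree T N m) (mk : market R k tr)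
    (G : 'I_N -> R)
    (hG0 : 0 < G (root_node tr))
    (hG : forall i : 'I_N, (0 < inner_level tr i)%N -> G i < 0)
    (p : 'rV[R]_m) (theta : R)
    (ps : nat -> 'rV[R]_m) (thetas : nat -> R)
    (hp : simplex R m p)
    (hpc : forall j : 'I_m, j \in critical tr -> p ord0 j = 0)
    (hna : arbitrage_free mk p)
    (htheta : 0 < theta)
    (hps : forall nu : nat, simplex R m (ps nu))
    (hthetas : forall nu : nat, 0 < thetas nu)
    (hpcvg : ps @ \oo --> p)
    (hthetacvg : thetas @ \oo --> theta) :
  epi_converges (fun nu : nat => f1 mk G (ps nu) (thetas nu)) (f1 mk G p theta)
  /\
  epi_converges (fun nu : nat => f1_tilde mk G (ps nu) (thetas nu))
                (f1_tilde mk G p theta).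
Proof.
(* Makes the clipping level [- ps nu] nonpositive, so that clipping preserves [u <= 0]. *)
have ps0 nu : nonneg_orthant (ps nu) by have [] := hps nu.
split.
- rewrite f1E; under eq_fun do rewrite f1E.
  apply: (epi_converges_iota (F := fun nu => finite_part mk (ps nu) (thetas nu))
    (A := fun nu => effective_domain mk G (ps nu))) => [zs z|zs z|z [Xf pu]].
  + exact: cvg_finite_part.
  + exact: effective_domain_near_notin.
  + have [us [usu pus _]] := recovery_sequence hpcvg pu.
    (* The strategy stays constant because the feasible set does not vary with [nu]. *)
    exists (fun nu => (us nu, z.2)); split=> [|nu]; last by split.
    exact: (cvg_pair usu (cvg_cst z.2)).
- rewrite f1_tildeE; under eq_fun do rewrite f1_tildeE.
  apply: (epi_converges_iota (F := fun nu => finite_part mk (ps nu) (thetas nu))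
    (A := fun nu => effective_domain mk G (ps nu) `&`
      [set z | nonpos_orthant z.1])) => [zs z|zs z zsz|z [[Xf pu] u0]].
  + exact: cvg_finite_part.
  (* A violation of [u <= 0] alone is handled by closedness of the nonpositive orthant. *)
  + have [zd|zd _] := pselect (effective_domain mk G p z); last first.
      have := effective_domain_near_notin hpcvg zsz zd.
      by apply: filterS => nu h [].
    have [u0 []//|u0 _] := pselect (nonpos_orthant z.1).
    have us : (fun nu => (zs nu).1) @ \oo --> z.1 by exact: cvg_prod_fst.
    have := closed_near_notin (@closed_nonpos_orthant R m) us u0.
    by apply: filterS => nu h [].
  + have [us [usu pus us0]] := recovery_sequence hpcvg pu.
    exists (fun nu => (us nu, z.2)); split=> [|nu]; last first.
      by split; [split|exact: us0].
    exact: (cvg_pair usu (cvg_cst z.2)).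
Qed.
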